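(* Let $m,n,d\in\mathbb{N}$ and let $\mathcal{H}_{\mathrm{MF}}:\mathbb{R}^{d\times m}\times\mathbb{R}^{d\times n}\to\mathbb{R}^{m\times n}$ be given by $\mathcal{H}_{\mathrm{MF}}(X,Y):=X^{\mathrm T}Y$. Given $(X,Y)\in\mathbb{R}^{d\times m}\times\mathbb{R}^{d\times n}$ with columns $x_1,\dots,x_m$ of $X$ and $y_1,\dots,y_n$ of $Y$, if $$d\ge \dim\bigl(\operatorname{span}(\{x_i\}_{i=1}^m\cup\{y_j\}_{j=1}^n)\bigr)+\min\{m,n\},$$ then $\mathcal{H}_{\mathrm{MF}}$ is locally surjective at $(X,Y)$. In particular, if $$d\ge m+n+\min\{m,n\},$$ then $\mathcal{H}_{\mathrm{MF}}$ is locally surjective at every point of $\mathbb{R}^{d\times m}\times\mathbb{R}^{d\times n}$.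
   Context: $\mathbb{N}$ is the set of positive integers. Spaces of matrices and their products are Euclidean spaces with the Frobenius norm (for a pair, the norm of the concatenation), and $\mathbb{B}$ denotes the closed unit ball of the relevant space. A mapping $\mathcal{F}$ between Euclidean spaces is locally surjective at $x$ (has the local surjection property at $x$) if for any $t>0$ there exists $r>0$ such that $\mathcal{F}(x)+r\mathbb{B}\subseteq\mathcal{F}(x+t\mathbb{B})$. *)

(* Defs.v *)
From HB Require Import structures.
From mathcomp Require Import all_boot all_order all_algebra.
From mathcomp Require Import classical_sets reals.

Set Implicit Arguments.
Unset Strict Implicit.
Unset Printing Implicit Defensive.

Import Order.TTheory GRing.Theory Num.Theory.
Local Open Scope ring_scope.
Local Open Scope classical_set_scope.

(* The norm that MathComp-Analysis puts on matrices and on products is the sup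
   norm, so the Euclidean ones are defined here. *)
Definition frob_norm (R : realType) (p q : nat) (A : 'M[R]_(p, q)) : R :=
  Num.sqrt (\sum_(i < p) \sum_(j < q) A i j ^+ 2).

Definition frob_norm_pair (R : realType) (p q p' q' : nat)
    (P : 'M[R]_(p, q) * 'M[R]_(p', q')) : R :=
  Num.sqrt (frob_norm P.1 ^+ 2 + frob_norm P.2 ^+ 2).

Definition unit_ball (R : realType) (U : lmodType R) (N : U -> R) : set U :=
  [set u | N u <= 1].

Definition trans_ball (R : realType) (U : lmodType R) (N : U -> R)
    (x : U) (t : R) : set U :=
  [set x + t *: u | u in unit_ball N].

(* [NU] and [NV] are the norms of the two Euclidean spaces. *)
Definition locally_surjective (R : realType) (U V : lmodType R)
    (NU : U -> R) (NV : V -> R) (F : U -> V) (x : U) : Prop :=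
  forall t : R, 0 < t ->
    exists r : R, 0 < r /\ trans_ball NV (F x) r `<=` F @` trans_ball NU x t.

Definition H_MF (R : realType) (m n d : nat)
    (P : 'M[R]_(d, m) * 'M[R]_(d, n)) : 'M[R]_(m, n) :=
  P.1^T *m P.2.

Definition columns_span (R : realType) (m n d : nat)
    (X : 'M[R]_(d, m)) (Y : 'M[R]_(d, n)) : {vspace 'cV[R]_d} :=
  <<[seq col i X | i <- enum 'I_m] ++ [seq col j Y | j <- enum 'I_n]>>%VS.

(* Main.v *)
(** Assume m <= n.  The orthogonal complement of the span of all columns has
    dimension at least m, so it contains the columns of some d x m matrix U of
    full column rank, and W := U (U^T U)^-1 satisfies U^T W = 1.  All cross terms
    vanish in (X + aU)^T (Y + bWE) = X^T Y + ab E, which therefore reaches every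
    target X^T Y + ab E with |E| <= 1, for a and b as small as we like.  The case
    n < m follows by transposition. *)
Require Import Defs.
From mathcomp Require Import all_boot all_order all_algebra.
From mathcomp Require Import classical_sets reals.
From mathcomp Require Import lra.

Import Order.TTheory GRing.Theory Num.Theory.

Local Open Scope ring_scope.

Section FrobeniusNorm.
Set Implicit Arguments.
Unset Strict Implicit.
Context {R : realType}.

Lemma frob_norm_ge0 p q (A : 'M[R]_(p, q)) : 0 <= frob_norm A.
Proof. exact: sqrtr_ge0. Qed.

Lemma sqr_frob_norm p q (A : 'M[R]_(p, q)) :
  frob_norm A ^+ 2 = \sum_(i < p) \sum_(j < q) A i j ^+ 2.
Proof.
by rewrite sqr_sqrtr //; do 2!apply: sumr_ge0 => ? _; exact: sqr_ge0.
Qed.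

Lemma frob_normZ p q (c : R) (A : 'M[R]_(p, q)) :
  frob_norm (c *: A) = `|c| * frob_norm A.
Proof.
rewrite /frob_norm -sqrtr_sqr -sqrtrM ?sqr_ge0 //; congr Num.sqrt.
rewrite mulr_sumr; apply: eq_bigr => i _; rewrite mulr_sumr.
by apply: eq_bigr => j _; rewrite mxE exprMn.
Qed.

Lemma frob_norm_tr p q (A : 'M[R]_(p, q)) : frob_norm A^T = frob_norm A.
Proof.
rewrite /frob_norm exchange_big; congr Num.sqrt.
by do 2!apply: eq_bigr => ? _; rewrite mxE.
Qed.

Lemma entry_le_frob_norm p q (A : 'M[R]_(p, q)) i j : `|A i j| <= frob_norm A.
Proof.
rewrite -(ler_pXn2r (n := 2)) ?nnegrE ?frob_norm_ge0 //.
rewrite sqr_frob_norm real_normK ?num_real // (bigD1 i) //= (bigD1 j) //=.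
rewrite -addrA lerDl addr_ge0 //; do ?[apply: sumr_ge0 => ? _]; exact: sqr_ge0.
Qed.

(** The entries of [E] are at most 1 in absolute value, so each entry of [W *m E] is bounded by the
    absolute row sum of [W]. The point is that [C] does not depend on [E], so that one radius can
    serve all targets. *)
Lemma frob_norm_mul_bounded p q s (W : 'M[R]_(p, q)) :
  exists2 C, 0 <= C &
    forall E : 'M[R]_(q, s), frob_norm E <= 1 -> frob_norm (W *m E) <= C.
Proof.
exists (Num.sqrt (\sum_(i < p) \sum_(j < s) (\sum_(k < q) `|W i k|) ^+ 2)).
  exact: sqrtr_ge0.
move=> E E1; apply: ler_wsqrtr; do 2!apply: ler_sum => ? _.
rewrite -real_normK ?num_real //; apply: lerXn2r; rewrite ?nnegrE //.
  exact: sumr_ge0.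
rewrite mxE; apply: le_trans (ler_norm_sum _ _ _) _; apply: ler_sum => k _.
by rewrite normrM ler_piMr // (le_trans (entry_le_frob_norm _ _ _)).
Qed.

End FrobeniusNorm.

Section MatrixFactorization.
Set Implicit Arguments.
Unset Strict Implicit.
Context {R : realType}.

(** If [v] kills the Gram matrix, then [(v *m V) *m (v *m V)^T = 0]. Its only entry is the sum of
    squares of the entries of [v *m V], which therefore vanishes, and row freeness gives [v = 0]. *)
Lemma gram_unitmx m d (V : 'M[R]_(m, d)) : row_free V -> V *m V^T \in unitmx.
Proof.
move=> Vfree; rewrite -row_free_unit; apply: inj_row_free => v vVV.
apply/eqP; rewrite -(mulmx_free_eq0 v Vfree); apply/eqP.
have /matrixP/(_ 0 0) : (v *m V) *m (v *m V)^T = 0.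
  by rewrite trmx_mul mulmxA -(mulmxA v) vVV mul0mx.
rewrite !mxE => /eqP; rewrite psumr_eq0 => [/allP w0|k _]; last first.
  by rewrite [in X in _ * X]mxE -expr2 sqr_ge0.
apply/matrixP => i j; rewrite ord1 [RHS]mxE; apply/eqP.
by have := w0 j (mem_index_enum j); rewrite [in X in _ * X]mxE mulf_eq0 orbb.
Qed.

(** [V] is the transpose of the matrix U of the overview: its rows are independent vectors of the
    left kernel of [B], whose columns form a basis of the span. *)
Lemma free_annihilator m n d k (X : 'M[R]_(d, m)) (Y : 'M[R]_(d, n)) :
  (\dim (columns_span X Y) + k <= d)%N ->
  exists V : 'M[R]_(k, d), [/\ row_free V, V *m X = 0 & V *m Y = 0].
Proof.
set S := columns_span X Y => le_d.
pose B := \matrix_(i < d, j < \dim S) (vbasis S)`_j i 0.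
have killS r (V : 'M[R]_(r, d)) v : V *m B = 0 -> v \in S -> V *m v = 0.
  move=> VB /coord_vbasis ->; rewrite mulmx_sumr big1 // => j _.
  have -> : (vbasis S)`_j = col j B.
    by apply/matrixP => a b; rewrite !mxE ord1.
  by rewrite -scalemxAr colE mulmxA VB mul0mx scaler0.
have killcols r q (V : 'M[R]_(r, d)) (Z : 'M[R]_(d, q)) :
    V *m B = 0 -> (forall j, col j Z \in S) -> V *m Z = 0.
  move=> VB ZS; apply/matrixP => i j.
  have /matrixP/(_ i 0) := killS _ V _ VB (ZS j).
  by rewrite colE mulmxA -colE !mxE.
(* The kernel has rank [d - \rank B], and [B] has only [\dim S] columns. *)
have le_k : (k <= \rank (kermx B))%N.
  rewrite mxrank_ker leq_subRL ?rank_leq_row //.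
  by apply: leq_trans le_d; rewrite leq_add2r rank_leq_col.
(* Multiplying by [pid_mx k] keeps the first [k] rows of a basis of the kernel; [le_k] ensures that
   there are that many. *)
exists (pid_mx k *m row_base (kermx B)).
have VB : pid_mx k *m row_base (kermx B) *m B = 0 :> 'M_(k, _).
  by apply/sub_kermxP; apply: submx_trans (submxMl _ _) _; rewrite eq_row_base.
split; last 2 first.
- apply: killcols VB _ => j; apply: memv_span.
  by rewrite mem_cat; apply/orP; left; apply: map_f; rewrite mem_enum.
- apply: killcols VB _ => j; apply: memv_span.
  by rewrite mem_cat; apply/orP; right; apply: map_f; rewrite mem_enum.
by rewrite /row_free mxrankMfree ?row_base_free // rank_pid_mx.
Qed.

Lemma locally_surjective_annihilator m n d
    (X : 'M[R]_(d, m)) (Y : 'M[R]_(d, n)) (V : 'M[R]_(m, d)) :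
  row_free V -> V *m X = 0 -> V *m Y = 0 ->
  locally_surjective (@frob_norm_pair R d m d n) (@frob_norm R m n)
    (@H_MF R m n d) (X, Y).
Proof.
move=> Vfree VX VY t t0.
(* A right inverse of [V] whose columns lie in the row space of [V], hence are orthogonal to the
   columns of [X]. *)
pose W := V^T *m invmx (V *m V^T).
have VW : V *m W = 1%:M by rewrite mulmxA mulmxV // gram_unitmx.
have XW : X^T *m W = 0 by rewrite mulmxA -trmx_mul VX trmx0 mul0mx.
have [C C0 WC] := frob_norm_mul_bounded n W.
have half_gt0 (x : R) : 0 <= x -> 0 < (2 * (1 + x))^-1.
  by move=> x0; rewrite invr_gt0; lra.
have half_le (x y : R) : 0 <= y -> y <= x -> (2 * (1 + x))^-1 * y <= 2^-1.
  by move=> y0 yx; rewrite mulrC ler_pdivrMr; lra.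
(* These scales bring both components of the perturbation to norm at most 1/2, so the pair has
   squared norm at most 1/4 + 1/4. The summand 1 keeps the denominators positive. *)
set a := (2 * (1 + frob_norm V^T))^-1; set b := (2 * (1 + C))^-1.
have a0 : 0 < a by exact: half_gt0 (frob_norm_ge0 _).
have b0 : 0 < b by exact: half_gt0.
exists ((t * a) * (t * b)); split; first by rewrite !mulr_gt0.
move=> _ [E E1 <-].
exists ((X, Y) + t *: (a *: V^T, b *: (W *m E))).
  exists (a *: V^T, b *: (W *m E)) => //.
  rewrite /unit_ball /= /frob_norm_pair /= !frob_normZ !gtr0_norm //.
  rewrite -[leRHS]sqrtr1; apply: ler_wsqrtr.
  have := half_le _ _ (frob_norm_ge0 V^T) (lexx _); rewrite -/a => aV.
  have := half_le _ _ (frob_norm_ge0 (W *m E)) (WC _ E1); rewrite -/b => bW.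
  have aV0 : 0 <= a * frob_norm V^T by rewrite mulr_ge0 ?frob_norm_ge0 ?ltW.
  have bW0 : 0 <= b * frob_norm (W *m E) by rewrite mulr_ge0 ?frob_norm_ge0 ?ltW.
  by nra.
rewrite /H_MF /= !scalerA.
have -> : (X + (t * a) *: V^T)^T = X^T + (t * a) *: V.
  by rewrite linearD linearZ /= trmxK.
(* The cross terms vanish by [VY] and [XW], and [VW] reduces the last product to a multiple of
   [E]. *)
rewrite mulmxDl !mulmxDr -!scalemxAl -!scalemxAr VY scaler0 add0r.
by rewrite 2!(mulmxA _ W) XW VW mul0mx mul1mx scaler0 addr0 scalerA.
Qed.

(** Swapping the factors transposes the product, and both the swap and transposition are isometries,
    so the same [r] works. *)
Lemma locally_surjective_swap m n d (X : 'M[R]_(d, m)) (Y : 'M[R]_(d, n)) :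
  locally_surjective (@frob_norm_pair R d n d m) (@frob_norm R n m)
    (@H_MF R n m d) (Y, X) ->
  locally_surjective (@frob_norm_pair R d m d n) (@frob_norm R m n)
    (@H_MF R m n d) (X, Y).
Proof.
move=> surj t /surj [r [r0 sub]]; exists r; split=> // _ [E E1 <-].
have /sub [_ [[u v] uv1 <-] Huv] :
    trans_ball (@frob_norm R n m) (H_MF (Y, X)) r (H_MF (Y, X) + r *: E^T).
  by exists E^T => //; rewrite /unit_ball /= frob_norm_tr.
exists ((X, Y) + t *: (v, u)).
  by exists (v, u) => //; move: uv1; rewrite /unit_ball /frob_norm_pair /= addrC.
apply: trmx_inj; move: Huv; rewrite /H_MF /= trmx_mul trmxK => ->.
by rewrite linearD linearZ /= trmx_mul trmxK.
Qed.

Lemma columns_spanC m n d (X : 'M[R]_(d, m)) (Y : 'M[R]_(d, n)) :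
  columns_span X Y = columns_span Y X.
Proof. by rewrite /columns_span !span_cat addvC. Qed.

Lemma dim_columns_span m n d (X : 'M[R]_(d, m)) (Y : 'M[R]_(d, n)) :
  (\dim (columns_span X Y) <= m + n)%N.
Proof.
by apply: leq_trans (dim_span _) _; rewrite size_cat (size_map (fun i => col i X)) size_enum_ord
  (size_map (fun j => col j Y)) size_enum_ord.
Qed.

End MatrixFactorization.

Theorem theorem3p6 (R : realType) (m n d : nat)
    (hm : (0 < m)%N) (hn : (0 < n)%N) (hd : (0 < d)%N) :
  (forall (X : 'M[R]_(d, m)) (Y : 'M[R]_(d, n)),
     (\dim (columns_span X Y) + minn m n <= d)%N ->
     locally_surjective (@frob_norm_pair R d m d n) (@frob_norm R m n)
       (@H_MF R m n d) (X, Y)) /\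
  ((m + n + minn m n <= d)%N ->
   forall (X : 'M[R]_(d, m)) (Y : 'M[R]_(d, n)),
     locally_surjective (@frob_norm_pair R d m d n) (@frob_norm R m n)
       (@H_MF R m n d) (X, Y)).
Proof.
have main (X : 'M[R]_(d, m)) (Y : 'M[R]_(d, n)) :
     (\dim (columns_span X Y) + minn m n <= d)%N ->
     locally_surjective (@frob_norm_pair R d m d n) (@frob_norm R m n)
       (@H_MF R m n d) (X, Y).
  have [_|_] := leqP m n.
    move=> /free_annihilator [V [Vfree VX VY]].
    exact: locally_surjective_annihilator VX VY.
  (* Here the minimum is [n], so [V] has [n] rows and suits the swapped pair [(Y, X)]. *)
  rewrite columns_spanC => /free_annihilator [V [Vfree VY VX]].
  exact/locally_surjective_swap/(locally_surjective_annihilator Vfree).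
split=> // le_d X Y; apply: main; apply: leq_trans le_d.
by rewrite leq_add2r dim_columns_span.
Qed.
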